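(* Let $\mathcal{Z}=(Z_n)_{n\in\mathbb{N}}$ be a stationary sequence of random variables taking values in $S^1\cup\{0\}$, and let $m\in\mathbb{N}_{\ge2}\cup\{\infty\}$. Suppose that almost surely the random sequence $\mathcal{Z}$ has index $m$. Then $\mathcal{Z}$ is almost surely a Chowla sequence if and only if $$\mathbb{E}\left[Z_{a_1}^{(i_1)}\cdot Z_{a_2}^{(i_2)}\cdots Z_{a_r}^{(i_r)}\right]=0$$ for every $r\ge1$, all integers $1\le a_1<\dots<a_r$ and all $i_1,\dots,i_r\in I(m)$ not all equal to $0$.
   Context: $\mathbb{N}=\{0,1,2,\dots\}$, $\mathbb{N}_{\ge 2}=\mathbb{N}\setminus\{0,1\}$, and $S^1$ is the unit circle in $\mathbb{C}$. For $m\in\mathbb{N}_{\ge2}$ let $U(m)=\{e^{2\pi i k/m}:0\le k\le m-1\}$, and $U(\infty)=S^1$. The index of a sequence $z=(z(n))_{n\in\mathbb{N}}\in(S^1\cup\{0\})^{\mathbb{N}}$ is the smallest $m\in\mathbb{N}_{\ge2}\cup\{\infty\}$ such that $\{n\in\mathbb{N}: z(n)\notin U(m)\cup\{0\}\}$ has density zero in $\mathbb{N}$, i.e. $\frac1N\#\{0\le n\le N-1: z(n)\notin U(m)\cup\{0\}\}\to0$. For $x\in S^1\cup\{0\}$ and $n\in\mathbb{Z}$, put $x^{(n)}=x^n$ if $x\in S^1$ and $x^{(n)}=0$ if $x=0$; write $z^{(i)}(n)=(z(n))^{(i)}$. Let $I(m)=\{0,1,\dots,m-1\}$ if $m\in\mathbb{N}_{\ge2}$,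 and $I(\infty)=\mathbb{Z}$. A sequence $z\in(S^1\cup\{0\})^{\mathbb{N}}$ of index $m$ has the Chowla property (is a Chowla sequence) if $$\lim_{N\to\infty}\frac1N\sum_{n=0}^{N-1} z^{(i_1)}(n+a_1)\,z^{(i_2)}(n+a_2)\cdots z^{(i_r)}(n+a_r)=0$$ for every $r\ge1$, all integers $0\le a_1<\dots<a_r$ and all $i_1,\dots,i_r\in I(m)$ not all equal to $0$. *)

(* Defs.v *)
From HB Require Import structures.
From mathcomp Require Import all_boot all_order all_algebra.
From mathcomp Require Import complex.
From mathcomp Require Import all_classical all_reals all_analysis.

Set Implicit Arguments.
Unset Strict Implicit.
Unset Printing Implicit Defensive.

Import Order.TTheory GRing.Theory Num.Theory.
Import numFieldNormedType.Exports.

Local Open Scope classical_set_scope.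
Local Open Scope complex_scope.
Local Open Scope ring_scope.

(* R[i] carries the topology of its norm, as the regular module over itself. *)
HB.instance Definition _ (R : realType) := NormedModule.copy R[i] R[i]^o.

(* The Borel sigma-algebra of the complex plane R[i]. *)
Definition borelC (R : realType) := g_sigma_algebraType (@open R[i]).

Section Sequences.
Variable R : realType.
Implicit Types (x : R[i]) (z : nat -> R[i]) (A : set nat).

Definition unit_circle : set R[i] := [set x | `|x| = 1].

(* An element m of {2, 3, ...} \cup {oo} is encoded in [option nat], with
   [None] standing for oo. *)
Definition is_order (m : option nat) : Prop :=
  if m is Some k then (2 <= k)%N else True.

Definition order_le (m m' : option nat) : Prop :=
  match m, m' with
  | Some k, Some l => (k <= l)%N
  | _, None => True
  | None, Some _ => False
  end.

Definition U (m : option nat) : set R[i] :=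
  if m is Some m' then
    [set x | exists2 k : nat, (k < m')%N &
       x = cos (2 * pi * k%:R / m'%:R) +i* sin (2 * pi * k%:R / m'%:R)]
  else unit_circle.

Definition density_zero A : Prop :=
  (fun N : nat => #|[pred n : 'I_N | `[< A n >]]|%:R / N%:R : R) @ \oo --> (0 : R).

Definition mostly_in_U z (m : option nat) : Prop :=
  density_zero [set n | ~ (U m `|` [set 0]) (z n)].

Definition has_index z (m : option nat) : Prop :=
  [/\ is_order m, mostly_in_U z m &
      forall m', is_order m' -> mostly_in_U z m' -> order_le m m'].

(* Differs from [x ^ n] at x = 0, n = 0, where it is 0 rather than 1. *)
Definition cpow x (n : int) : R[i] := if x == 0 then 0 else x ^ n.

Definition exponents (m : option nat) : set int :=
  if m is Some k then [set i | 0 <= i < k%:Z] else setT.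

Definition increasing (r : nat) (a : 'I_r -> nat) : Prop :=
  forall s t : 'I_r, (s < t)%N -> (a s < a t)%N.

Definition chowla_averages z (m : option nat) : Prop :=
  forall (r : nat) (a : 'I_r -> nat) (i : 'I_r -> int),
    (1 <= r)%N -> increasing a ->
    (forall s, exponents m (i s)) -> ~ (forall s, i s = 0) ->
    (fun N : nat => N%:R^-1 *
       \sum_(0 <= n < N) \prod_(s < r) cpow (z (n + a s)%N) (i s) : R[i])
      @ \oo --> (0 : R[i]).

Definition is_chowla z : Prop :=
  exists2 m, has_index z m & chowla_averages z m.

(* The product sigma-algebra on complex sequences, generated by the
   coordinate maps. *)
Definition seq_measurable : set (set (nat -> R[i])) :=
  <<s [set A | exists n : nat, exists2 B : set (borelC R),
        measurable B & A = [set z | B (z n)]] >>.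

End Sequences.

Section Process.
Context (R : realType) (d : measure_display) (T : measurableType d).
Variable P : probability T R.

Definition stationary (Z : nat -> T -> R[i]) : Prop :=
  forall (k : nat) (A : set (nat -> R[i])), seq_measurable A ->
    P [set w | A (fun n => Z (n + k)%N w)] = P [set w | A (fun n => Z n w)].

(* Meaningful for integrable X, in particular for bounded random variables. *)
Definition expectationC (X : T -> R[i]) : R[i] :=
  fine 'E_P[fun w => complex.Re (X w)] +i* fine 'E_P[fun w => complex.Im (X w)].

End Process.

(* Main.v *)
Require Import Defs.
From HB Require Import structures.
From mathcomp Require Import all_boot all_order all_algebra.
From mathcomp Require Import complex.
From mathcomp Require Import ring lra zify.
From mathcomp Require Import all_classical all_reals all_analysis.
From mathcomp Require Import measurable_realfun.

Set Implicit Arguments.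
Unset Strict Implicit.
Unset Printing Implicit Defensive.

Import Order.TTheory GRing.Theory Num.Theory.
Import numFieldNormedType.Exports.

Local Open Scope classical_set_scope.
Local Open Scope ring_scope.

(** For n <> n' the product of the monomial shifted by n with the conjugate of
    the monomial shifted by n' is, after merging exponents modulo m, again a
    monomial with exponents in I(m); the exponent at the position of the first
    nonzero i_s in the earlier factor survives, so all the correlations vanish
    when all the expectations do.  The shifts of a monomial are thus bounded and
    orthogonal, and the strong law of large numbers holds for them by the
    classical argument along squares: no ergodic theorem is needed.  Reduction
    modulo m uses that Z_n almost surely lies in U(m) or vanishes, since the
    density of exceptions tends to 0 and has constant mean.  The converse
    direction is stationarity and dominated convergence. *)

Local Notation Re := complex.Re.
Local Notation Im := complex.Im.
Local Notation conj := (@conjc _).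
Local Notation disk := (@unit_circle _ `|` [set 0]).

(** * Complex numbers through their real and imaginary parts *)

Section Complex.
Variable R : realType.
Implicit Types (x y : R[i]).

(** The norm of [R[i]] takes its values in [R[i]]; this squared modulus is real-valued, so it can be
    integrated. *)
Definition sqnorm x : R := Re x ^+ 2 + Im x ^+ 2.

Lemma sqnorm_ge0 x : 0 <= sqnorm x.
Proof. by rewrite addr_ge0 ?sqr_ge0. Qed.

Lemma normc_sqr x : `|x| ^+ 2 = (sqnorm x)%:C%C.
Proof. by rewrite -add_Re2_Im2. Qed.

Lemma sqnormM x y : sqnorm (x * y) = sqnorm x * sqnorm y.
Proof. by case: x y => a b [c d]; rewrite /sqnorm /=; ring. Qed.

Lemma sqnormB x y : sqnorm (x - y) = sqnorm x + sqnorm y - 2 * Re (x * conj y).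
Proof. by case: x y => a b [c d]; rewrite /sqnorm /=; ring. Qed.

Lemma normc_le x (e : R) : 0 <= e -> (`|x| <= e%:C%C) = (sqnorm x <= e ^+ 2).
Proof.
move=> e0; rewrite -lecR -normc_sqr rmorphXn /=.
by rewrite ler_sqr // ?nnegrE ?ler0c ?normr_ge0.
Qed.

Lemma ReD x y : Re (x + y) = Re x + Re y.
Proof. by case: x y => ? ? []. Qed.

Lemma ImD x y : Im (x + y) = Im x + Im y.
Proof. by case: x y => ? ? []. Qed.

Lemma Re_sum (I : Type) (s : seq I) (F : I -> R[i]) :
  Re (\sum_(i <- s) F i) = \sum_(i <- s) Re (F i).
Proof. by elim/big_ind2 : _ => // ? ? ? ? <- <-; rewrite ReD. Qed.

Lemma Im_sum (I : Type) (s : seq I) (F : I -> R[i]) :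
  Im (\sum_(i <- s) F i) = \sum_(i <- s) Im (F i).
Proof. by elim/big_ind2 : _ => // ? ? ? ? <- <-; rewrite ImD. Qed.

Lemma natc_inv n : (n%:R^-1 : R[i]) = (n%:R^-1)%:C%C.
Proof. by rewrite (fmorphV (real_complex R)) rmorph_nat. Qed.

Lemma Re_scale (c : R) x : Re (c%:C%C * x) = c * Re x.
Proof. by case: x => a b /=; rewrite mul0r subr0. Qed.

Lemma Im_scale (c : R) x : Im (c%:C%C * x) = c * Im x.
Proof. by case: x => a b /=; rewrite mul0r addr0. Qed.

Lemma Re_sqr_le_sqnorm x : Re x ^+ 2 <= sqnorm x.
Proof. by rewrite lerDl sqr_ge0. Qed.

Lemma Im_sqr_le_sqnorm x : Im x ^+ 2 <= sqnorm x.
Proof. by rewrite lerDr sqr_ge0. Qed.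

Lemma cvgc0P (f : nat -> R[i]) :
  f @ \oo --> (0 : R[i]) <-> (fun n => sqnorm (f n)) @ \oo --> (0 : R).
Proof.
split=> [/cvgr0Pnorm_le h|/cvgr0Pnorm_le h].
- apply/cvgr0Pnorm_le => e e0.
  have s0 : 0 < Num.sqrt e by rewrite sqrtr_gt0.
  have := h (Num.sqrt e)%:C%C; rewrite ltcR => /(_ s0).
  apply: filterS => n; rewrite normc_le ?(ltW s0)// sqr_sqrtr ?(ltW e0)//.
  by rewrite ger0_norm ?sqnorm_ge0.
- apply/cvgr0Pnorm_le => e e0.
  (* A positive element of [R[i]] is real, so the complex tolerance is a real one in disguise. *)
  have e1 : e = (Re e)%:C%C by rewrite RRe_real// ger0_real ?ltW.
  have e2 : 0 < Re e by rewrite -ltcR -e1.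
  have := h (Re e ^+ 2); rewrite exprn_gt0// => /(_ isT).
  apply: filterS => n; rewrite e1 normc_le ?(ltW e2)//.
  by rewrite ger0_norm ?sqnorm_ge0.
Qed.

Lemma cvg_Re0 (f : nat -> R[i]) :
  f @ \oo --> (0 : R[i]) -> (fun n => Re (f n)) @ \oo --> (0 : R).
Proof.
move=> /cvgr0Pnorm_le h; apply/cvgr0Pnorm_le => e e0.
have := h e%:C%C; rewrite ltcR => /(_ e0).
apply: filterS => n; rewrite normc_le ?(ltW e0)// => /(le_trans (Re_sqr_le_sqnorm _)).
by rewrite -real_normK ?num_real// ler_sqr ?nnegrE ?(ltW e0).
Qed.

Lemma cvg_Im0 (f : nat -> R[i]) :
  f @ \oo --> (0 : R[i]) -> (fun n => Im (f n)) @ \oo --> (0 : R).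
Proof.
move=> /cvgr0Pnorm_le h; apply/cvgr0Pnorm_le => e e0.
have := h e%:C%C; rewrite ltcR => /(_ e0).
apply: filterS => n; rewrite normc_le ?(ltW e0)// => /(le_trans (Im_sqr_le_sqnorm _)).
by rewrite -real_normK ?num_real// ler_sqr ?nnegrE ?(ltW e0).
Qed.

Lemma continuous_Re : continuous (@complex.Re R).
Proof.
move=> x; apply/(@cvgrPdist_le _ _ _ _ (nbhs_filter x)) => e e0.
have ec0 : 0 < e%:C%C by rewrite ltcR.
apply: filterS (nbhsx_ballx x _ ec0) => y.
rewrite -ball_normE => /= /ltW; rewrite normc_le ?(ltW e0)//.
move=> /(le_trans (Re_sqr_le_sqnorm _)).
rewrite -real_normK ?num_real// ler_sqr ?nnegrE ?(ltW e0)//.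
by rewrite ReD; case: y.
Qed.

Lemma continuous_Im : continuous (@complex.Im R).
Proof.
move=> x; apply/(@cvgrPdist_le _ _ _ _ (nbhs_filter x)) => e e0.
have ec0 : 0 < e%:C%C by rewrite ltcR.
apply: filterS (nbhsx_ballx x _ ec0) => y.
rewrite -ball_normE => /= /ltW; rewrite normc_le ?(ltW e0)//.
move=> /(le_trans (Im_sqr_le_sqnorm _)).
rewrite -real_normK ?num_real// ler_sqr ?nnegrE ?(ltW e0)//.
by rewrite ImD; case: y.
Qed.

(** Open intervals generate the Borel sets of the line, and their preimages under f are open, hence
    generators of [borelC]. *)
Lemma measurable_borelC (f : R[i] -> R) : continuous f ->
  measurable_fun [set: borelC R] (f : borelC R -> R).
Proof.
move=> /continuousP cf; apply: (measurability _ (RGenOpens.measurableE R)).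
move=> _ [_ [a [b ->] <-]]; rewrite setTI.
by apply: sub_sigma_algebra; apply: cf; exact: interval_open.
Qed.

End Complex.

(** * The modified powers on the circle together with 0 *)

Section Cpow.
Variable R : realType.
Implicit Types (x y : R[i]).


Lemma unit_conj x : unit_circle x -> x * conj x = 1.
Proof. by rewrite /unit_circle /= -sqr_normc => ->; rewrite expr1n. Qed.

Lemma unit_circle_neq0 x : unit_circle x -> x != 0.
Proof. by move=> h; rewrite -normr_eq0 h oner_eq0. Qed.

Lemma unit_conjV x : unit_circle x -> conj x = x^-1.
Proof.
move=> ux; apply: (mulfI (unit_circle_neq0 ux)).
by rewrite unit_conj// divff// unit_circle_neq0.
Qed.

Lemma cpow0 (n : int) : cpow (0 : R[i]) n = 0.
Proof. by rewrite /cpow eqxx. Qed.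

Lemma cpow_unit x n : unit_circle x -> cpow x n = x ^ n.
Proof. by move=> /unit_circle_neq0/negbTE; rewrite /cpow => ->. Qed.

(* A polynomial in x and its conjugate agreeing with [cpow] on the circle and
   at 0; in particular |x|^2 stands for the indicator of x != 0. *)
Definition cpoly x (n : int) : R[i] :=
  match n with
  | Posz 0 => x * conj x
  | Posz k => x ^+ k
  | Negz k => conj x ^+ k.+1
  end.

(** On the circle the conjugate is the inverse. This replaces the case distinction at 0 by a
    polynomial expression, whose measurability is immediate. *)
Lemma cpowE x n : disk x -> cpow x n = cpoly x n.
Proof.
case=> [ux|->].
  rewrite cpow_unit//; case: n => [[|n]|n] //=; first by rewrite unit_conj.
  by rewrite unit_conjV// exprVn.
by rewrite cpow0 /cpoly; case: n => [[|n]|n]; rewrite ?mul0r ?conjc0 ?expr0n.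
Qed.

Lemma cpow_disk x n : disk x -> disk (cpow x n).
Proof.
case=> [ux|->]; last by rewrite cpow0; right.
left; rewrite cpow_unit// /unit_circle /=.
by case: n => n /=; rewrite ?normfV normrX ux expr1n ?invr1.
Qed.

Lemma cpow_conj x n : disk x -> conj (cpow x n) = cpow x (- n).
Proof.
case=> [ux|->]; last by rewrite !cpow0 conjc0.
rewrite unit_conjV; last first.
  have [//|/eqP] := @cpow_disk x n (or_introl ux).
  by rewrite cpow_unit// expfz_eq0 (negbTE (unit_circle_neq0 ux)) andbF.
by rewrite !cpow_unit// invr_expz.
Qed.

(** The convention that [cpow 0 0] is 0 makes this true at x = 0 even when the exponents cancel. *)
Lemma cpowD x m n : cpow x m * cpow x n = cpow x (m + n).
Proof.
rewrite /cpow; have [_|x0] := eqVneq x 0; first by rewrite mul0r.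
by rewrite expfzDr.
Qed.

(** The single equation in the hypothesis covers both x = 0 and the k-th roots of unity. *)
Lemma cpow_mod x (k : nat) n : x ^+ k.+1 = x -> cpow x n = cpow x (n %% k%:Z)%Z.
Proof.
rewrite /cpow; have [//|x0] := eqVneq x 0.
rewrite exprS -[X in _ = X]mulr1 => /(mulfI x0) xk.
rewrite {1}(divz_eq n k%:Z) expfzDr//.
have -> : x ^ ((n %/ k%:Z)%Z * k%:Z) = 1.
  by rewrite mulrC -exprz_exp -[x ^ k%:Z]/(x ^+ k) xk exp1rz.
by rewrite mul1r.
Qed.

Lemma diskM x y : disk x -> disk y -> disk (x * y).
Proof.
move=> [ux|->]; last by rewrite mul0r; right.
move=> [uy|->]; last by rewrite mulr0; right.
by left; rewrite /unit_circle /= normrM ux uy mulr1.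
Qed.

Lemma disk_prod (I : finType) (F : I -> R[i]) :
  (forall s, disk (F s)) -> disk (\prod_s F s).
Proof.
move=> h; elim/big_ind : _ => //; last exact: diskM.
by left; rewrite /unit_circle /= normr1.
Qed.

Lemma disk_conj x : disk x -> disk (conj x).
Proof.
case=> [ux|->]; last by rewrite conjc0; right.
by left; rewrite /unit_circle /= normcJ.
Qed.

Lemma disk_sqnorm x : disk x -> sqnorm x <= 1.
Proof.
move=> h; rewrite -lecR -normc_sqr; case: h => [->|->].
  by rewrite expr1n.
by rewrite normr0 expr0n /= ler01.
Qed.

Lemma Re_le_sqnorm x (M : R) : 0 <= M -> sqnorm x <= M ^+ 2 -> `|Re x| <= M.
Proof.
move=> M0 /(le_trans (Re_sqr_le_sqnorm x)).
by rewrite -real_normK ?num_real// ler_sqr ?nnegrE.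
Qed.

Lemma Im_le_sqnorm x (M : R) : 0 <= M -> sqnorm x <= M ^+ 2 -> `|Im x| <= M.
Proof.
move=> M0 /(le_trans (Im_sqr_le_sqnorm x)).
by rewrite -real_normK ?num_real// ler_sqr ?nnegrE.
Qed.

Lemma disk_Re x : disk x -> `|Re x| <= 1.
Proof. by move=> h; apply: Re_le_sqnorm; rewrite // expr1n disk_sqnorm. Qed.

Lemma disk_Im x : disk x -> `|Im x| <= 1.
Proof. by move=> h; apply: Im_le_sqnorm; rewrite // expr1n disk_sqnorm. Qed.

Lemma U_expr x (k : nat) : (0 < k)%N -> U (Some k) x -> x ^+ k = 1.
Proof.
move=> k0 [j _ ->].
(* De Moivre's formula. *)
have deM (t : R) n :
    Complex (cos t) (sin t) ^+ n = Complex (cos (t *+ n)) (sin (t *+ n)).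
  elim: n => [|n ih]; first by rewrite mulr0n cos0 sin0.
  by rewrite exprS ih mulrS cosD sinD [sin t * _ + _]addrC.
rewrite deM.
have -> : 2 * pi * j%:R / k%:R *+ k = pi *+ 2 *+ j :> R.
  rewrite -mulr_natr divfK ?pnatr_eq0 -?lt0n//.
  by rewrite mulr_natr mulr_natl.
have -> : cos (pi *+ 2 *+ j) = 1 :> R.
  elim: j => [|j ih]; first by rewrite mulr0n cos0.
  by rewrite mulrSr cosD2pi.
have -> : sin (pi *+ 2 *+ j) = 0 :> R.
  elim: j => [|j ih]; first by rewrite mulr0n sin0.
  by rewrite mulrSr sinD2pi.
by [].
Qed.

End Cpow.

(** * Measurability of complex-valued functions *)

Section ComplexMeasurable.
Context {d : measure_display} {T : measurableType d} {R : realType}.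
Implicit Types X Y : T -> R[i].

Definition cmeasurable X :=
  measurable_fun setT (fun w => Re (X w)) /\
  measurable_fun setT (fun w => Im (X w)).

Lemma cmeasurable_borelC (X : T -> borelC R) :
  measurable_fun setT X -> cmeasurable X.
Proof.
move=> mX; split.
- exact: measurableT_comp (measurable_borelC (@continuous_Re R)) mX.
- exact: measurableT_comp (measurable_borelC (@continuous_Im R)) mX.
Qed.

Lemma cmeasurable_cst (c : R[i]) : cmeasurable (cst c).
Proof. by split; exact: measurable_cst. Qed.

Lemma cmeasurableD X Y : cmeasurable X -> cmeasurable Y ->
  cmeasurable (fun w => X w + Y w).
Proof.
move=> [mX mX'] [mY mY']; split; under eq_fun do rewrite ?ReD ?ImD;
exact: measurable_funD.
Qed.

Lemma ReM (x y : R[i]) : Re (x * y) = Re x * Re y - Im x * Im y.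
Proof. by case: x y => ? ? []. Qed.

Lemma ImM (x y : R[i]) : Im (x * y) = Re x * Im y + Im x * Re y.
Proof. by case: x y => ? ? []. Qed.

Lemma cmeasurableM X Y : cmeasurable X -> cmeasurable Y ->
  cmeasurable (fun w => X w * Y w).
Proof.
move=> [mX mX'] [mY mY']; split; under eq_fun do rewrite ?ReM ?ImM.
- by apply: measurable_funB; exact: measurable_funM.
- by apply: measurable_funD; exact: measurable_funM.
Qed.

Lemma cmeasurable_conj X : cmeasurable X -> cmeasurable (fun w => conj (X w)).
Proof.
move=> [mX mX']; split.
- by apply: eq_measurable_fun mX => w _; case: (X w).
- apply: eq_measurable_fun (measurableT_comp (@oppr_measurable R setT) mX') => w _.
  by rewrite /=; case: (X w).
Qed.

Lemma cmeasurableX X n : cmeasurable X -> cmeasurable (fun w => X w ^+ n).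
Proof.
move=> mX; elim: n => [|n ih]; first exact: cmeasurable_cst.
by under [X in cmeasurable X]eq_fun do rewrite exprS; exact: cmeasurableM.
Qed.

Lemma cmeasurable_prod (I : Type) (s : seq I) (F : I -> T -> R[i]) :
  (forall i, cmeasurable (F i)) -> cmeasurable (fun w => \prod_(i <- s) F i w).
Proof.
move=> mF; elim: s => [|i s ih].
  by under [X in cmeasurable X]eq_fun do rewrite big_nil; exact: cmeasurable_cst.
by under [X in cmeasurable X]eq_fun do rewrite big_cons; exact: cmeasurableM.
Qed.

Lemma cmeasurable_cpoly X n : cmeasurable X -> cmeasurable (fun w => cpoly (X w) n).
Proof.
move=> mX; case: n => [[|n]|n].
- by apply: cmeasurableM => //; exact: cmeasurable_conj.
- exact: cmeasurableX.
- by apply: cmeasurableX; exact: cmeasurable_conj.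
Qed.

Lemma measurable_sqnorm X : cmeasurable X -> measurable_fun setT (fun w => sqnorm (X w)).
Proof.
by move=> [mX mX']; apply: measurable_funD; exact: measurable_funX.
Qed.

End ComplexMeasurable.

(** * Integration of bounded measurable functions *)

Section BoundedMeasurable.
Context {d : measure_display} {T : measurableType d} {R : realType}.
Variable P : probability T R.
Implicit Types f g : T -> R.

(** Unlike integrability, this condition is stable under products; it implies integrability because
    P is finite. *)
Definition bmeasurable f :=
  measurable_fun setT f /\ exists M, forall w, `|f w| <= M.

Lemma bmeasurable_integrable f : bmeasurable f -> P.-integrable setT (EFin \o f).
Proof.
move=> [mf [M hM]]; apply: measurable_bounded_integrable => //.
  exact: le_lt_trans (probability_le1 P measurableT) (ltry 1).
exists M; split; first exact: num_real.
by move=> x Mx w _ /=; exact: le_trans (hM w) (ltW Mx).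
Qed.

Lemma bmeasurableD f g : bmeasurable f -> bmeasurable g ->
  bmeasurable (fun w => f w + g w).
Proof.
move=> [mf [M hM]] [mg [N hN]]; split; first exact: measurable_funD.
by exists (M + N) => w; apply: le_trans (ler_normD _ _) _; exact: lerD.
Qed.

Lemma bmeasurable_cst c : bmeasurable (cst c).
Proof. by split; [exact: measurable_cst|exists `|c|]. Qed.

Lemma bmeasurableM f g : bmeasurable f -> bmeasurable g ->
  bmeasurable (fun w => f w * g w).
Proof.
move=> [mf [M hM]] [mg [N hN]]; split; first exact: measurable_funM.
by exists (M * N) => w; rewrite normrM; exact: ler_pM.
Qed.

Lemma bmeasurable_sum (I : Type) (s : seq I) (F : I -> T -> R) :
  (forall i, bmeasurable (F i)) -> bmeasurable (fun w => \sum_(i <- s) F i w).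
Proof.
move=> mF; elim: s => [|i s ih].
  by under [X in bmeasurable X]eq_fun do rewrite big_nil; exact: bmeasurable_cst.
by under [X in bmeasurable X]eq_fun do rewrite big_cons; exact: bmeasurableD.
Qed.

Lemma Rintegral_bsum (I : Type) (s : seq I) (F : I -> T -> R) :
  (forall i, bmeasurable (F i)) ->
  \int[P]_w (\sum_(i <- s) F i w) = \sum_(i <- s) \int[P]_w F i w.
Proof.
move=> mF; elim: s => [|i s ih].
  rewrite big_nil; under eq_Rintegral do rewrite big_nil.
  by rewrite Rintegral_cst// mul0r.
rewrite big_cons -ih -RintegralD//; last 2 first.
- exact: bmeasurable_integrable.
- by apply: bmeasurable_integrable; exact: bmeasurable_sum.
by apply: eq_Rintegral => w _; rewrite big_cons.
Qed.

Lemma Rintegral_bscale c f : bmeasurable f ->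
  \int[P]_w (c * f w) = c * \int[P]_w f w.
Proof. by move=> /bmeasurable_integrable h; rewrite RintegralZl. Qed.

Lemma ae_eq_Rintegral f g : bmeasurable f -> bmeasurable g ->
  {ae P, forall w, f w = g w} -> \int[P]_w f w = \int[P]_w g w.
Proof.
move=> [mf _] [mg _] fg; congr fine; apply: ae_eq_integral => //.
- exact/measurable_EFinP.
- exact/measurable_EFinP.
by apply: filterS fg => w fgw _; rewrite fgw.
Qed.

Lemma Rintegral_eq0_ae f : bmeasurable f -> (forall w, 0 <= f w) ->
  \int[P]_w f w = 0 -> {ae P, forall w, f w = 0}.
Proof.
move=> bf f0 If0.
have := @ae_eq_integral_abs _ _ _ P setT measurableT (EFin \o f).
case=> [|h _]; first by apply/measurable_EFinP; case: bf.
apply: filterS (h _) => [w /(_ I) []//|].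
under eq_integral => w _ do rewrite /= ger0_norm//.
(* [fine] also sends infinite values to 0, so finiteness of the integral is needed to conclude that
   it is 0. *)
rewrite -[LHS]fineK; first by rewrite [fine _]If0.
exact: (integrable_fin_num measurableT (bmeasurable_integrable bf)).
Qed.

Lemma dominated_Rintegral0 (F : nat -> T -> R) (M : R) :
  (forall n, measurable_fun setT (F n)) -> (forall n w, `|F n w| <= M) ->
  {ae P, forall w, F ^~ w @ \oo --> (0 : R)} ->
  (fun n => \int[P]_w F n w) @ \oo --> (0 : R).
Proof.
move=> mF bF cF.
have [|||||_ _] := @dominated_convergence _ _ _ P setT measurableT
  (fun n => EFin \o F n) (cst 0%E) (cst M%:E).
- by move=> n; exact/measurable_EFinP.
- exact: measurable_cst.
- by apply: filterS cF => w cFw _; apply/fine_cvgP; split => //; near=> n.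
- exact: finite_measure_integrable_cst.
- by apply: aeW => w n _; rewrite /= lee_fin.
rewrite integral0 => h; exact: fine_cvg h.
Unshelve. all: by end_near. Qed.

End BoundedMeasurable.

(** * Sequence space and consequences of stationarity *)

Definition cylinders (R : realType) : set (set (nat -> R[i])) :=
  [set A | exists n : nat, exists2 B : set (borelC R),
     measurable B & A = [set z | B (z n)]].

(** Its measurable sets are, by conversion, the sets [seq_measurable] on which [stationary] is
    tested. *)
Definition seqspace (R : realType) := g_sigma_algebraType (@cylinders R).

Section Stationary.
Context {R : realType} {d : measure_display} {T : measurableType d}.
Context {P : probability T R} {Z : nat -> {RV P >-> borelC R}}.

Definition sample_path (k : nat) (w : T) : nat -> R[i] := fun n => Z (n + k)%N w.

Lemma measurable_path k : measurable_fun setT (sample_path k : T -> seqspace R).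
Proof.
apply: measurability; first by [].
move=> _ [_ [n [B mB ->] <-]].
exact: (measurable_funPT (Z (n + k)%N)).
Qed.

Lemma measurable_coord n : measurable_fun setT (fun z : seqspace R => z n : borelC R).
Proof.
move=> _ B mB; rewrite setTI; apply: sub_sigma_algebra.
by exists n; exists B.
Qed.

(** Polynomials in the coordinates are unbounded on the whole sequence space; only the values on
    possible paths count. *)
Definition bounded_on_disk (g : (nat -> R[i]) -> R) :=
  exists M, forall z, (forall n, disk (z n)) -> `|g z| <= M.

Hypothesis Zdisk : forall n w, disk (Z n w).

Lemma path_disk k w n : disk (sample_path k w n).
Proof. exact: Zdisk. Qed.

Lemma bmeasurable_path g k : measurable_fun setT (g : seqspace R -> R) ->
  bounded_on_disk g -> bmeasurable (fun w => g (sample_path k w)).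
Proof.
move=> mg [M hM]; split; first exact: measurableT_comp mg (measurable_path k).
by exists M => w; apply: hM => n; exact: path_disk.
Qed.

Hypothesis statZ : stationary P Z.

(** Stationarity says that the shifted and unshifted paths have the same law; both integrals are
    integrals of g against that law. *)
Lemma Rintegral_path g k : measurable_fun setT (g : seqspace R -> R) ->
  bounded_on_disk g ->
  \int[P]_w g (sample_path k w) = \int[P]_w g (sample_path 0 w).
Proof.
move=> mg bg; congr fine.
have mg' : measurable_fun setT (EFin \o g : seqspace R -> \bar R).
  exact/measurable_EFinP.
have trans j : (\int[P]_w (g (sample_path j w))%:E =
    \int[pushforward P (sample_path j : T -> seqspace R)]_z (g z)%:E)%E.
  rewrite (integral_pushforward (measurable_path j) mg')//.
  exact: bmeasurable_integrable (bmeasurable_path _ mg bg).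
rewrite !trans; apply: eq_measure_integral => [||m0 mk A mA _];
  try exact: measurable_path.
rewrite /pushforward /preimage /=.
have -> : sample_path 0 = fun w n => Z n w.
  by apply/funext => w; apply/funext => n; rewrite /sample_path addn0.
exact (statZ k mA).
Qed.

(* By stationarity the averages have constant mean, and that mean tends to 0. *)
Lemma Rintegral_ergodic_average_eq0 g : measurable_fun setT (g : seqspace R -> R) ->
  bounded_on_disk g ->
  {ae P, forall w, (fun N : nat => N%:R^-1 * \sum_(0 <= n < N) g (sample_path n w))
                     @ \oo --> (0 : R)} ->
  \int[P]_w g (sample_path 0 w) = 0.
Proof.
move=> mg bg cg.
have bsum N : bmeasurable (fun w => \sum_(0 <= n < N) g (sample_path n w)).
  by apply: bmeasurable_sum => n; exact: bmeasurable_path.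
have [M hM] := bg.
have h : (fun N => \int[P]_w (N%:R^-1 * \sum_(0 <= n < N) g (sample_path n w)))
    @ \oo --> (0 : R).
  apply: (@dominated_Rintegral0 _ _ _ P _ M) => // [N|N w].
    by apply: measurable_funM; [exact: measurable_cst|case: (bsum N)].
  have M0 : 0 <= M by apply: le_trans (hM (sample_path 0 w) _) => // n; exact: path_disk.
  rewrite normrM normfV normr_nat mulrC.
  (* The average over N = 0 terms is 0, as the inverse of 0 is 0. *)
  have [->|N0] := posnP N; first by rewrite invr0 mulr0.
  rewrite ler_pdivrMr ?ltr0n//; apply: le_trans (ler_norm_sum _ _ _) _.
  rewrite mulr_natr -[X in _ *+ X]subn0 -sumr_const_nat.
  by apply: ler_sum => n _; apply: hM => j; exact: path_disk.
rewrite -[RHS](cvg_lim (@Rhausdorff R) h); apply/esym/cvg_lim => //.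
apply: cvg_near_cst; near=> N.
rewrite Rintegral_bscale// Rintegral_bsum; last by move=> n; exact: bmeasurable_path.
under eq_bigr do rewrite Rintegral_path//.
rewrite sumr_const_nat subn0 -[X in _ * X]mulr_natl mulKf// pnatr_eq0 -lt0n.
by near: N; exact: nbhs_infty_gt.
Unshelve. all: by end_near. Qed.

End Stationary.

(** * Averages along the squares *)

Section Averages.
Context {R : realType}.
Implicit Types x : nat -> R[i].

Definition average x (N : nat) : R[i] := N%:R^-1 * \sum_(0 <= n < N) x n.

Lemma average_scale x N : average x N = (N%:R^-1 : R)%:C%C * \sum_(0 <= n < N) x n.
Proof. by rewrite /average natc_inv. Qed.

Lemma sqnorm_average x N :
  sqnorm (average x N) = N%:R ^- 2 * sqnorm (\sum_(0 <= n < N) x n).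
Proof.
by rewrite average_scale sqnormM /sqnorm /= expr0n addr0 exprVn.
Qed.

Lemma exists_square_interval N : (0 < N)%N ->
  exists k, (k.+1 ^ 2 <= N < k.+2 ^ 2)%N.
Proof.
case: N => // N _; elim: N => [|N [k /andP[kN Nk]]]; first by exists 0%N.
have [h|h] := ltnP N.+2 (k.+2 ^ 2); first by exists k; rewrite h andbT ltnW.
exists k.+1; rewrite h /=; apply: (leq_ltn_trans Nk).
by rewrite ltn_exp2r.
Qed.

(** For N between (k+1)^2 and (k+2)^2 - 1 the sum has at most 2(k+1) terms beyond the first (k+1)^2.
    Divided by (k+1)^2, they contribute at most 2/(k+1). *)
Lemma average_cvg0_squares x : (forall n, `|x n| <= 1) ->
  (fun k => average x (k.+1 ^ 2)) @ \oo --> (0 : R[i]) ->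
  average x @ \oo --> (0 : R[i]).
Proof.
move=> x1 /cvgr0Pnorm_le h; apply/cvgr0Pnorm_le => e e0.
have e20 : 0 < e / 2 by rewrite divr_gt0.
have [K1 _ hK1] := h _ e20.
have [K2 hK2] : exists K2 : nat, forall k, (K2 <= k)%N -> 2 / k.+1%:R <= e / 2 :> R[i].
  have er : e = (Re e)%:C%C by rewrite RRe_real// ger0_real ?ltW.
  have re0 : 0 < Re e by rewrite -ltcR -er.
  (* The condition 2/(k+1) <= e/2 amounts to 4/e <= k+1. *)
  exists (Num.truncn (4 / Re e)) => k hk.
  rewrite ler_pdivrMr ?ltr0n// mulrAC ler_pdivlMr// -natrM er.
  rewrite -(rmorph_nat (real_complex R)) -(rmorph_nat (real_complex R) k.+1).
  rewrite -rmorphM lecR.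
  rewrite -ler_pdivrMl// mulrC.
  apply: ltW; apply: lt_le_trans (truncnS_gt _) _.
  by rewrite ler_nat.
pose K := maxn K1 K2.
(* From (K+1)^2 <= N < (k+2)^2 follows K <= k, so both bounds hold at k. *)
exists (K.+1 ^ 2)%N => // N /= hN.
have N0 : (0 < N)%N by apply: leq_trans hN; rewrite expn_gt0.
have [k /andP[kN Nk]] := exists_square_interval N0.
have Kk : (K <= k)%N.
  have := leq_ltn_trans hN Nk; rewrite ltn_exp2r//.
have Sle : `|\sum_(k.+1 ^ 2 <= n < N) x n| <= (2 * k.+1)%:R.
  apply: le_trans (ler_norm_sum _ _ _) _.
  apply: (@le_trans _ _ (\sum_(k.+1 ^ 2 <= n < N) 1)); first exact: ler_sum.
  rewrite sumr_const_nat ler_nat; nia.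
have Hk := hK1 k (leq_trans (leq_maxl _ _) Kk).
have Hk2 := hK2 k (leq_trans (leq_maxr _ _) Kk).
have m0 : (0 : R[i]) < (k.+1 ^ 2)%:R by rewrite ltr0n expn_gt0.
rewrite /average normrM normfV normr_nat (big_cat_nat (leq0n _) kN)//=.
apply: (@le_trans _ _
  ((k.+1 ^ 2)%:R^-1 * (`|\sum_(0 <= n < k.+1 ^ 2) x n| + (2 * k.+1)%:R))).
  apply: ler_pM; rewrite ?invr_ge0 ?normr_ge0 ?ler0n//.
    by rewrite lef_pV2 ?posrE ?ler_nat ?ltr0n.
  by apply: le_trans (ler_normD _ _) _; rewrite lerD2l.
rewrite mulrDr (splitr e); apply: lerD.
  by move: Hk; rewrite /average normrM normfV normr_nat.
apply: le_trans Hk2; rewrite natrM natrX expr2 invfM -mulrA.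
by rewrite [2 * _]mulrC mulKf ?pnatr_eq0// mulrC.
Qed.

End Averages.

(** * Strong law for bounded orthogonal variables *)

Section Orthogonal.
Context {d : measure_display} {T : measurableType d} {R : realType}.
Context {P : probability T R}.

(** The sum of the F k has finite expectation, so it is almost surely finite, and the terms of a
    convergent series tend to 0. *)
Lemma summable_Rintegral_cvg0 (F : nat -> T -> R) (C : R) :
  (forall k, bmeasurable (F k)) -> (forall k w, 0 <= F k w) ->
  (forall n, \sum_(0 <= k < n) \int[P]_w F k w <= C) ->
  {ae P, forall w, F ^~ w @ \oo --> (0 : R)}.
Proof.
move=> bF F0 FC.
pose G w := (\sum_(0 <= k <oo) (F k w)%:E)%E.
have mF k : measurable_fun setT (EFin \o F k).
  by apply/measurable_EFinP; case: (bF k).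
have G0 w : (0 <= G w)%E by apply: nneseries_ge0 => k _ _; rewrite lee_fin.
have mG : measurable_fun setT G.
  by apply: ge0_emeasurable_sum => [k w _ _|k _]; [rewrite lee_fin|exact: mF].
have iG : P.-integrable setT G.
  apply/integrableP; split => //.
  under eq_integral => w _ do rewrite gee0_abs//.
  rewrite integral_nneseries//; last by move=> k w _; rewrite lee_fin.
  apply: (@le_lt_trans _ _ C%:E); last exact: ltry.
  apply: lime_le.
    by apply: is_cvg_nneseries => k _ _; apply: integral_ge0 => w _; rewrite lee_fin.
  apply: nearW => n.
  apply: le_trans (_ : (\sum_(0 <= k < n) \int[P]_w F k w)%:E <= _)%E; last first.
    by rewrite lee_fin.
  rewrite -sumEFin; apply: lee_sum => k _; rewrite /Rintegral fineK//.
  by apply: integrable_fin_num => //; exact: bmeasurable_integrable (bF k).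
apply: filterS (integrable_ae measurableT iG) => w /(_ I) Gfin.
apply: cvg_series_cvg_0; apply: nondecreasing_is_cvgn.
  by apply: nondecreasing_series => k _.
exists (fine (G w)) => _ [n _ <-].
rewrite -lee_fin fineK// /series /= -sumEFin.
by apply: nneseries_lim_ge => k _; rewrite lee_fin.
Qed.

Lemma sum_inv_squares_le2 n : \sum_(0 <= k < n) (k.+1 ^ 2)%:R^-1 <= 2 :> R.
Proof.
(* The sharper bound passes through the induction: with a = n+1, the slack gained at each step is
   1/(a(a+1)^2). *)
suff h : \sum_(0 <= k < n.+1) (k.+1 ^ 2)%:R^-1 <= 2 - n.+1%:R^-1 :> R.
  apply: (@le_trans _ _ (2 - n.+1%:R^-1)); last by rewrite gerBl invr_ge0.
  by apply: le_trans h; rewrite [leRHS]big_nat_recr//= lerDl invr_ge0.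
elim: n => [|n ih]; first by rewrite big_nat1 exp1n invr1; lra.
rewrite big_nat_recr//=; apply: le_trans (lerD ih (lexx _)) _.
have a0 : 0 < n.+1%:R :> R by rewrite ltr0n.
rewrite natrX -[n.+2]addn1 natrD; set a : R := n.+1%:R in a0 *.
rewrite -subr_ge0.
have -> : 2 - (a + 1)^-1 - (2 - a^-1 + (a + 1) ^- 2) = (a * (a + 1) ^+ 2)^-1.
  by field; rewrite ?gt_eqF// addr_gt0.
by rewrite invr_ge0 mulr_ge0// ?sqr_ge0 ?ltW.
Qed.

Variable X : nat -> T -> R[i].
Hypothesis mX : forall n, cmeasurable (X n).
Hypothesis X1 : forall n w, sqnorm (X n w) <= 1.
Hypothesis orthX : forall n n', (n < n')%N ->
  \int[P]_w Re (X n w * conj (X n' w)) = 0.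

Let S N w := \sum_(0 <= n < N) X n w.

Let normX1 n w : `|X n w| <= 1.
Proof. by rewrite -[1]/(1%:C%C) normc_le ?expr1n. Qed.

Let mS N : cmeasurable (S N).
Proof.
elim: N => [|N ih].
  by under [Y in cmeasurable Y]eq_fun do rewrite /S big_geq//; exact: cmeasurable_cst.
under [Y in cmeasurable Y]eq_fun do rewrite /S big_nat_recr//=.
exact: cmeasurableD.
Qed.

Let sqnorm_S_le N w : sqnorm (S N w) <= N%:R ^+ 2.
Proof.
rewrite -normc_le ?ler0n// rmorph_nat; apply: le_trans (ler_norm_sum _ _ _) _.
rewrite -[N in leRHS]subn0 -sumr_const_nat; exact: ler_sum.
Qed.

Let bS N : bmeasurable (fun w => sqnorm (S N w)).
Proof.
split; first exact: measurable_sqnorm.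
by exists (N%:R ^+ 2) => w; rewrite ger0_norm ?sqnorm_ge0.
Qed.

Let bcorr n n' : bmeasurable (fun w => Re (X n w * conj (X n' w))).
Proof.
split.
  by case: (cmeasurableM (mX n) (cmeasurable_conj (mX n'))).
exists 1 => w; apply: Re_le_sqnorm; rewrite // expr1n sqnormM.
apply: mulr_ile1; rewrite ?sqnorm_ge0//.
by have := X1 n' w; case: (X n' w) => a b; rewrite /sqnorm /= sqrrN.
Qed.

(** Expand the square of S N + X N: the cross terms integrate to 0 by orthogonality and the square
    of X N adds at most 1. *)
Let Rintegral_sqnorm_S N : \int[P]_w sqnorm (S N w) <= N%:R.
Proof.
elim: N => [|N ih].
  under eq_Rintegral do rewrite /S big_geq// /sqnorm expr0n addr0.
  by rewrite Rintegral_cst// mul0r.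
have bX : bmeasurable (fun w => sqnorm (X N w)).
  split; first exact: measurable_sqnorm.
  by exists 1 => w; rewrite ger0_norm ?sqnorm_ge0.
pose C w := \sum_(0 <= n < N) Re (X n w * conj (X N w)).
have bC : bmeasurable C by apply: bmeasurable_sum.
have -> : \int[P]_w sqnorm (S N.+1 w) =
    \int[P]_w (sqnorm (S N w) + sqnorm (X N w) + 2 * C w).
  apply: eq_Rintegral => w _; rewrite /S big_nat_recr//= -[X in sqnorm (_ + X)]opprK.
  rewrite sqnormB /C; set s := \sum_(0 <= n < N) X n w.
  rewrite -Re_sum -mulr_suml -/s /sqnorm.
  by case: s (X N w) => a b [a' b'] /=; ring.
have bC2 : bmeasurable (fun w => 2 * C w).
  by apply: bmeasurableM => //; exact: bmeasurable_cst.
rewrite RintegralD//; last 2 first.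
- by apply: bmeasurable_integrable; exact: bmeasurableD.
- exact: bmeasurable_integrable.
rewrite RintegralD//; try exact: bmeasurable_integrable.
rewrite Rintegral_bscale// Rintegral_bsum// big_nat big1 ?mulr0 ?addr0; last first.
  by move=> n /andP[_ nN]; exact: orthX.
rewrite -natr1; apply: lerD => //.
apply: le_trans (_ : \int[P]_w (cst (1 : R) w) <= _).
  apply: le_Rintegral => //; apply: bmeasurable_integrable => //.
  exact: bmeasurable_cst.
rewrite Rintegral_cst// mul1r -lee_fin fineK ?probability_le1//.
exact: fin_num_measure.
Qed.

(* The second moments of the averages along squares are summable, and between
   consecutive squares the averages barely move. *)
Lemma orthogonal_strong_law :
  {ae P, forall w, average (X ^~ w) @ \oo --> (0 : R[i])}.
Proof.
have := @summable_Rintegral_cvg0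
  (fun k w => sqnorm (average (X ^~ w) (k.+1 ^ 2))) 2.
have eF k : (fun w => sqnorm (average (X ^~ w) (k.+1 ^ 2))) =
    (fun w => (k.+1 ^ 2)%:R ^- 2 * sqnorm (S (k.+1 ^ 2) w)).
  by apply/funext => w; rewrite sqnorm_average.
have bF k : bmeasurable (fun w => sqnorm (average (X ^~ w) (k.+1 ^ 2))).
  by rewrite eF; apply: bmeasurableM => //; exact: bmeasurable_cst.
move=> /(_ bF) []; first by move=> k w; exact: sqnorm_ge0.
(* With N = (k+1)^2 the second moment of the average is at most N/N^2 = 1/(k+1)^2. *)
- move=> n; apply: le_trans (sum_inv_squares_le2 n).
  apply: ler_sum => k _; rewrite eF Rintegral_bscale//.
  apply: le_trans (ler_wpM2l _ (Rintegral_sqnorm_S _)) _.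
    by rewrite invr_ge0 exprn_ge0.
  by rewrite expr2 invfM -mulrA mulVf ?mulr1// pnatr_eq0 expn_eq0.
move=> A hA; exists A; case: hA => mA A0 sA; split => //.
apply: subset_trans sA => w /= nc h; apply: nc.
by apply: average_cvg0_squares => //; apply/cvgc0P.
Qed.

End Orthogonal.

(** * Monomials in the coordinates and their correlations *)

Section Monomials.
Context {R : realType}.
Implicit Types (x : R[i]) (z : nat -> R[i]) (l : seq (nat * int)).

(** At x = 0 an empty product would be 1, whereas [cpow 0 0] is 0; hence the nonempty index list. *)
Lemma prod_cpow (I : Type) (s : seq I) (F : I -> int) x : (0 < size s)%N ->
  \prod_(i <- s) cpow x (F i) = cpow x (\sum_(i <- s) F i).
Proof.
case: s => // j s _; elim: s j => [|k s ih] j; first by rewrite !big_seq1.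
by rewrite big_cons ih cpowD [in RHS]big_cons.
Qed.

Definition exponent_at l (p : nat) : int := \sum_(q <- l | q.1 == p) q.2.

(** Group the factors by position. Every listed position carries at least one factor, so a total
    exponent 0 still yields [cpow (z p) 0] and not 1. *)
Lemma prod_cpow_merge l z :
  \prod_(q <- l) cpow (z q.1) q.2 =
  \prod_(p <- undup (unzip1 l)) cpow (z p) (exponent_at l p).
Proof.
transitivity (\prod_(p <- undup (unzip1 l)) \prod_(q <- l | q.1 == p) cpow (z q.1) q.2).
  rewrite (exchange_big_dep xpredT)//= [LHS]big_seq [RHS]big_seq.
  apply: eq_bigr => q ql; under eq_bigl do rewrite eq_sym.
  rewrite -big_filter filter_pred1_uniq ?undup_uniq ?big_seq1//.
  by rewrite mem_undup map_f.
rewrite [LHS]big_seq [RHS]big_seq; apply: eq_bigr => p.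
rewrite mem_undup => /mapP[q0 q0l pE].
rewrite -big_filter /exponent_at -[in RHS]big_filter.
under eq_big_seq => q do [rewrite mem_filter => /andP[/eqP -> _]].
apply: prod_cpow; rewrite size_filter -has_count.
by apply/hasP; exists q0 => //; rewrite pE.
Qed.

(** Sorting without repetition puts the merged product in the form required by the Chowla property,
    with strictly increasing shifts. *)
Definition positions l := sort leq (undup (unzip1 l)).

Lemma mem_positions l p : (p \in positions l) = (p \in unzip1 l).
Proof. by rewrite mem_sort mem_undup. Qed.

Lemma positions_increasing l :
  increasing (fun j : 'I_(size (positions l)) => nth 0%N (positions l) j).
Proof.
move=> s t st.
have ss : sorted ltn (positions l).
  by rewrite ltn_sorted_uniq_leq sort_uniq undup_uniq sort_sorted//; exact: leq_total.
by rewrite (sorted_ltn_nth ltn_trans)// inE.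
Qed.

Lemma prod_cpow_positions l z :
  \prod_(q <- l) cpow (z q.1) q.2 =
  \prod_(j < size (positions l))
    cpow (z (nth 0%N (positions l) j)) (exponent_at l (nth 0%N (positions l) j)).
Proof.
rewrite prod_cpow_merge.
have pl : perm_eq (undup (unzip1 l)) (positions l).
  by rewrite perm_sym perm_sort.
by rewrite (perm_big _ pl) (big_nth 0%N) big_mkord.
Qed.

Definition reduce (m : option nat) (e : int) : int :=
  if m is Some k then (e %% k%:Z)%Z else e.

Lemma exponents_reduce m e : is_order m -> exponents m (reduce m e).
Proof.
case: m => [k|]//= k2; rewrite /exponents /=.
by rewrite modz_ge0 ?ltz_pmod//; lia.
Qed.

Lemma reduce_small m e : exponents m e -> reduce m e = e.
Proof. by case: m => [k|]//= h; rewrite modz_small. Qed.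

Variables (r : nat) (a : 'I_r -> nat) (i : 'I_r -> int).

Definition monomial z : R[i] := \prod_(s < r) cpow (z (a s)) (i s).

(** A version of [monomial] that is polynomial in the coordinates and their conjugates, hence
    visibly measurable on the whole sequence space. *)
Definition monomial_poly z : R[i] := \prod_(s < r) cpoly (z (a s)) (i s).

Lemma monomialE z : (forall n, disk (z n)) -> monomial z = monomial_poly z.
Proof. by move=> hz; apply: eq_bigr => s _; rewrite cpowE. Qed.

Lemma monomial_disk z : (forall n, disk (z n)) -> disk (monomial z).
Proof. by move=> hz; apply: disk_prod => s; exact: cpow_disk. Qed.

Lemma cmeasurable_monomial_poly : cmeasurable (monomial_poly : seqspace R -> R[i]).
Proof.
apply: cmeasurable_prod => s; apply: cmeasurable_cpoly.
exact: cmeasurable_borelC (@measurable_coord R (a s)).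
Qed.

Lemma bounded_Re_monomial : bounded_on_disk (fun z => Re (monomial_poly z)).
Proof.
by exists 1 => z hz; rewrite -monomialE//; apply: disk_Re; exact: monomial_disk.
Qed.

Lemma bounded_Im_monomial : bounded_on_disk (fun z => Im (monomial_poly z)).
Proof.
by exists 1 => z hz; rewrite -monomialE//; apply: disk_Im; exact: monomial_disk.
Qed.

(** Conjugation negates exponents. The two halves may share positions, so this list has to be merged
    before it describes a monomial. *)
Definition corr_terms n n' : seq (nat * int) :=
  [seq ((a s + n)%N, i s) | s <- index_enum 'I_r] ++
  [seq ((a s + n')%N, - i s) | s <- index_enum 'I_r].

Lemma monomial_corr z n n' : (forall j, disk (z j)) ->
  monomial (fun j => z (j + n)%N) * conj (monomial (fun j => z (j + n')%N)) =
  \prod_(q <- corr_terms n n') cpow (z q.1) q.2.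
Proof.
move=> hz; rewrite big_cat /= !big_map; congr (_ * _).
rewrite /monomial rmorph_prod; apply: eq_bigr => s _.
by rewrite -cpow_conj.
Qed.

Hypothesis a_incr : increasing a.

Lemma increasing_inj : injective a.
Proof.
move=> s t e; apply: val_inj.
by case: (ltngtP (val s) (val t)) => // /a_incr; rewrite e ltnn.
Qed.

Lemma increasing_mono s t : (a s < a t)%N -> (s < t)%N.
Proof.
move=> ast; case: (ltngtP (val s) (val t)) => // [/a_incr|/val_inj e].
  by rewrite ltnNge ltnW.
by rewrite e ltnn in ast.
Qed.

(* Below the position of the first nonzero exponent nothing cancels it. *)
Lemma corr_terms_neq0 n n' : (n < n')%N -> ~ (forall s, i s = 0) ->
  exists2 s, i s != 0 & exponent_at (corr_terms n n') (a s + n)%N = i s.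
Proof.
move=> nn' i0.
have [s0 s0P] : exists s, i s != 0.
  by apply/not_existsP => h; apply: i0 => s; have /negP := h s; rewrite negbK => /eqP.
case: (@arg_minnP _ s0 (fun s => i s != 0) val s0P) => s is0 smin.
exists s => //; rewrite /exponent_at big_cat /= !big_map /=.
rewrite (eq_bigl (pred1 s)) => [|t]; last first.
  by rewrite eqn_add2r (inj_eq increasing_inj).
rewrite big_pred1_eq big1 ?addr0// => t /eqP att'.
(* A factor of the second half at the same position has a t + n' = a s + n, so a t < a s and t < s;
   minimality of s makes its exponent 0. *)
have ts : (t < s)%N by apply: increasing_mono; lia.
by apply/eqP; rewrite oppr_eq0; apply: contraTT ts => it; rewrite -leqNgt smin.
Qed.

End Monomials.

Lemma has_index_unique (R : realType) (z : nat -> R[i]) m m' :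
  has_index z m -> has_index z m' -> m = m'.
Proof.
move=> [om zm minm] [om' zm' minm']; move: (minm _ om' zm') (minm' _ om zm).
by case: m m' {om zm minm om' zm' minm'} => [k|] [l|]//= kl lk;
  congr Some; apply/eqP; rewrite eqn_leq kl.
Qed.

Lemma ae_forall_countable d (T : measurableType d) (R : realType)
    (P : probability T R) (I : countType) (Q : I -> T -> Prop) :
  (forall i, {ae P, forall w, Q i w}) -> {ae P, forall w, forall i, Q i w}.
Proof.
move=> hQ.
have h : {ae P, forall w, forall n : nat, if unpickle n is Some i then Q i w else True}.
  apply/ae_foralln => n; case: (unpickle n) => [i|]; first exact: hQ.
  exact: aeW.
by apply: filterS h => w hw i; have := hw (pickle i); rewrite pickleK.
Qed.

(** * Both implications for a stationary process *)

Section Main.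
Context {R : realType} {d : measure_display} {T : measurableType d}.
Context {P : probability T R} {Z : nat -> {RV P >-> borelC R}}.
Notation zpath := (sample_path (Z := Z)).
Hypothesis Zdisk : forall n w, disk (Z n w).
Hypothesis statZ : stationary P Z.

Let pdisk k w n : disk (zpath k w n).
Proof. exact: path_disk. Qed.

(** Stationarity makes the expectation independent of the shift k, so it can be tested at shift
    0. *)
Lemma expectationC_monomial_eq0 r (a : 'I_r -> nat) (i : 'I_r -> int) k :
  expectationC P (fun w => monomial a i (zpath k w)) = 0 <->
  \int[P]_w Re (monomial_poly a i (zpath 0 w)) = 0 /\
  \int[P]_w Im (monomial_poly a i (zpath 0 w)) = 0.
Proof.
have [mRe mIm] := cmeasurable_monomial_poly a i (R := R).
rewrite /expectationC expectation.unlock.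
rewrite -(Rintegral_path Zdisk statZ k mRe (bounded_Re_monomial a i)).
rewrite -(Rintegral_path Zdisk statZ k mIm (bounded_Im_monomial a i)).
have e w : monomial a i (zpath k w) = monomial_poly a i (zpath k w).
  by apply: monomialE.
under [X in integral P setT X]eq_fun do rewrite e.
under [X in (_ +i* fine (integral P setT X))%C]eq_fun do rewrite e.
by split=> [[]|[]]; rewrite /Rintegral => -> ->.
Qed.

Lemma cmeasurable_path (X : seqspace R -> R[i]) k : cmeasurable X ->
  cmeasurable (fun w => X (zpath k w)).
Proof.
move=> [mX mX']; split.
- exact: measurableT_comp mX (measurable_path k).
- exact: measurableT_comp mX' (measurable_path k).
Qed.

Lemma prod_path0 r (a : 'I_r -> nat) (i : 'I_r -> int) w :
  \prod_(s < r) cpow (Z (a s) w) (i s) = monomial a i (zpath 0 w).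
Proof. by apply: eq_bigr => s _; rewrite /sample_path addn0. Qed.

Lemma average_path r (a : 'I_r -> nat) (i : 'I_r -> int) w :
  (fun N : nat => N%:R^-1 *
       \sum_(0 <= n < N) \prod_(s < r) cpow (Z (n + a s)%N w) (i s)) =
  average (fun n => monomial a i (zpath n w)).
Proof.
apply/funext => N; congr (_ * _); apply: eq_bigr => n _.
by apply: eq_bigr => s _; rewrite /sample_path addnC.
Qed.

Lemma chowla_expectation_eq0 r (a : 'I_r -> nat) (i : 'I_r -> int) :
  {ae P, forall w, average (fun n => monomial a i (zpath n w)) @ \oo --> (0 : R[i])} ->
  expectationC P (fun w => monomial a i (zpath 0 w)) = 0.
Proof.
move=> cvg0; apply/expectationC_monomial_eq0.
have [mRe mIm] := cmeasurable_monomial_poly a i (R := R).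
split.
- apply: (Rintegral_ergodic_average_eq0 Zdisk statZ mRe (bounded_Re_monomial a i)).
  apply: filterS cvg0 => w /cvg_Re0; apply: cvg_trans; apply: near_eq_cvg.
  apply: nearW => N; rewrite average_scale Re_scale Re_sum; congr (_ * _).
  by apply: eq_bigr => n _; rewrite monomialE.
- apply: (Rintegral_ergodic_average_eq0 Zdisk statZ mIm (bounded_Im_monomial a i)).
  apply: filterS cvg0 => w /cvg_Im0; apply: cvg_trans; apply: near_eq_cvg.
  apply: nearW => N; rewrite average_scale Im_scale Im_sum; congr (_ * _).
  by apply: eq_bigr => n _; rewrite monomialE.
Qed.

Lemma sum_indicator (A : set nat) N :
  #|[pred n : 'I_N | `[< A n >]]| = (\sum_(0 <= n < N) `[< A n >])%N.
Proof.
rewrite big_mkord -sum1_card big_mkcond /=; apply: eq_bigr => n _.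
by rewrite inE; case: `[< A n >].
Qed.

(* The density of indices outside U(k) tends to 0 almost surely and, by
   stationarity, its mean is constant. *)
Lemma index_root_of_unity (k : nat) : (0 < k)%N ->
  {ae P, forall w, has_index (fun n => Z n w) (Some k)} ->
  {ae P, forall w, forall n, Z n w ^+ k.+1 = Z n w}.
Proof.
move=> k0 idx.
(* A measurable substitute for the indicator of the exceptions: it vanishes exactly where z 0 is 0
   or a k-th root of unity. *)
pose g (z : nat -> R[i]) := sqnorm (z 0%N ^+ k.+1 - z 0%N).
have mg : measurable_fun setT (g : seqspace R -> R).
  have mz := cmeasurable_borelC (@measurable_coord R 0).
  apply: measurable_sqnorm.
  under [Y in cmeasurable Y]eq_fun do rewrite -mulN1r.
  apply: cmeasurableD; first exact: cmeasurableX.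
  by apply: cmeasurableM => //; exact: cmeasurable_cst.
have g4 z : disk (z 0%N) -> g z <= 4.
  move=> hz; rewrite (_ : 4 = 2 ^+ 2); last by ring.
  rewrite -normc_le//; apply: le_trans (ler_normB _ _) _.
  have z1 : `|z 0%N| <= 1 by case: hz => ->; rewrite ?normr0 ?ler01.
  rewrite (_ : 2%:C%C = 1 + 1); last by rewrite rmorph_nat.
  by apply: lerD => //; rewrite normrX exprn_ile1.
have bg : bounded_on_disk g.
  by exists 4 => z hz; rewrite ger0_norm ?sqnorm_ge0 ?g4.
have Ig : \int[P]_w g (zpath 0 w) = 0.
  apply: (Rintegral_ergodic_average_eq0 Zdisk statZ mg bg).
  apply: filterS idx => w [_ dens _].
  (* Since g is at most 4 at exceptional indices and 0 at the others, its averages are at most 4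
     times the proportion of exceptions. *)
  have h4 : (fun N : nat => 4 * (#|[pred n : 'I_N |
      `[< [set n | ~ (U (Some k) `|` [set 0]) (Z n w)] n >]]|%:R / N%:R) : R)
      @ \oo --> (0 : R).
    by have := cvgM (cvg_cst (4 : R)) dens; rewrite mulr0; exact.
  apply: (squeeze_cvgr _ (cvg_cst 0) h4); apply: nearW => N.
  apply/andP; split.
    by rewrite mulr_ge0 ?invr_ge0//; apply: sumr_ge0 => n _; exact: sqnorm_ge0.
  rewrite mulrA mulrC ler_wpM2r ?invr_ge0// sum_indicator natr_sum mulr_sumr.
  apply: ler_sum => n _; case: asboolP => /= h; first by rewrite mulr1 g4.
  rewrite mulr0 /g /sample_path add0n; move/contrapT: h => [/(U_expr k0) zk|->].
    by rewrite exprSr zk mul1r subrr /sqnorm /= expr0n addr0.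
  by rewrite expr0n subrr /sqnorm /= expr0n addr0.
apply/ae_foralln => n.
have : {ae P, forall w, g (zpath n w) = 0}.
  apply: Rintegral_eq0_ae => [|w|].
  - exact: bmeasurable_path.
  - exact: sqnorm_ge0.
  - by rewrite (Rintegral_path Zdisk statZ n mg bg).
apply: filterS => w; rewrite /g /sample_path add0n => /eqP g0.
apply/eqP; rewrite -subr_eq0 -normr_eq0 -sqrf_eq0 normc_sqr.
by rewrite (eqP g0).
Qed.

Variable m : option nat.
Hypothesis m_order : is_order m.
Hypothesis m_index : {ae P, forall w, has_index (fun n => Z n w) m}.
Hypothesis expectation0 : forall (r : nat) (a : 'I_r -> nat) (i : 'I_r -> int),
  (1 <= r)%N -> (forall s, (1 <= a s)%N) -> increasing a ->
  (forall s, exponents m (i s)) -> ~ (forall s, i s = 0) ->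
  expectationC P (fun w => \prod_(s < r) cpow (Z (a s) w) (i s)) = 0.

Lemma cpow_reduce_ae :
  {ae P, forall w, forall n e, cpow (Z n w) e = cpow (Z n w) (reduce m e)}.
Proof.
move: m_order m_index; case: m => [k|] km idx; last exact: aeW.
have := index_root_of_unity (ltnW km) idx.
by apply: filterS => w h n e; rewrite /=; exact: cpow_mod.
Qed.

Let Rintegral_monomial0 r (a : 'I_r -> nat) (i : 'I_r -> int) :
  (1 <= r)%N -> increasing a ->
  (forall s, exponents m (i s)) -> ~ (forall s, i s = 0) ->
  \int[P]_w Re (monomial_poly a i (zpath 0 w)) = 0.
Proof.
move=> r1 ainc im i0.
(* Shifting by 1 turns positions that may start at 0 into positions at least 1, as [expectation0]
   demands. *)
have /expectationC_monomial_eq0[] // :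
  expectationC P (fun w => monomial a i (zpath 1 w)) = 0.
have := @expectation0 r (fun s => (a s + 1)%N) i r1.
by apply => // [s|s t /ainc]; rewrite ?addn1.
Qed.

Lemma monomial_orthogonal r (a : 'I_r -> nat) (i : 'I_r -> int) n n' :
  increasing a -> (forall s, exponents m (i s)) -> ~ (forall s, i s = 0) ->
  (n < n')%N ->
  \int[P]_w Re (monomial_poly a i (zpath n w) *
                conj (monomial_poly a i (zpath n' w))) = 0.
Proof.
move=> ainc im i0 nn'.
pose l := corr_terms a i n n'.
pose b (j : 'I_(size (positions l))) := nth 0%N (positions l) j.
(* Merged exponents may be negative or too large; reduction returns them to I(m) and changes the
   product only on a null set. *)
pose e j := reduce m (exponent_at l (b j)).
have [s is0 es] := corr_terms_neq0 ainc nn' i0.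
have sl : (a s + n)%N \in positions l.
  rewrite mem_positions /l /unzip1 map_cat mem_cat -map_comp.
  by apply/orP; left; apply/mapP; exists s => //; exact: mem_index_enum.
have idx : (index (a s + n)%N (positions l) < size (positions l))%N.
  by rewrite index_mem.
rewrite -(@Rintegral_monomial0 _ b e); first last.
(* The surviving exponent i s already lies in I(m), so reduction leaves it nonzero. *)
- move=> /(_ (Ordinal idx)); rewrite /e /b /= nth_index// es reduce_small//.
  exact/eqP.
- by move=> j; exact: exponents_reduce.
- exact: positions_increasing.
- by apply: leq_ltn_trans idx.
have mX k : cmeasurable (fun w => monomial_poly a i (zpath k w)).
  exact: cmeasurable_path (cmeasurable_monomial_poly a i).
apply: ae_eq_Rintegral.
- split.
    by case: (cmeasurableM (mX n) (cmeasurable_conj (mX n'))).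
  exists 1 => w; apply: disk_Re; apply: diskM; last apply: disk_conj.
    by rewrite -monomialE//; exact: monomial_disk.
  by rewrite -monomialE//; exact: monomial_disk.
- have [mRe _] := cmeasurable_monomial_poly b e (R := R).
  exact: (bmeasurable_path Zdisk 0 mRe (bounded_Re_monomial b e)).
apply: filterS cpow_reduce_ae => w h; congr (Re _).
rewrite -!monomialE//.
have := eq_trans (monomial_corr a i n n' (Zdisk ^~ w))
  (prod_cpow_positions l (fun j => Z j w)).
rewrite /sample_path => ->.
by apply: eq_bigr => j _; rewrite addn0 h.
Qed.


Lemma average_monomial_cvg0 r (a : 'I_r -> nat) (i : 'I_r -> int) :
  increasing a -> (forall s, exponents m (i s)) -> ~ (forall s, i s = 0) ->
  {ae P, forall w, average (fun n => monomial a i (zpath n w)) @ \oo --> (0 : R[i])}.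
Proof.
move=> ainc im i0.
have e n w : monomial a i (zpath n w) = monomial_poly a i (zpath n w).
  exact: monomialE.
have := @orthogonal_strong_law _ _ _ P (fun n w => monomial a i (zpath n w)).
apply.
- move=> n; under [Y in cmeasurable Y]eq_fun do rewrite e.
  exact: cmeasurable_path (cmeasurable_monomial_poly a i).
- by move=> n w; apply: disk_sqnorm; exact: monomial_disk.
- move=> n n' nn'; under eq_Rintegral do rewrite !e.
  exact: monomial_orthogonal.
Qed.

(** One null set must serve all r, a and i. Coding each pair (a, i) as a finite function makes the
    choices countable, so the exceptional sets can be united. *)
Lemma chowla_averages_ae : {ae P, forall w, chowla_averages (fun n => Z n w) m}.
Proof.
have h : {ae P, forall w, forall r (f : {ffun 'I_r -> nat * int}),
    increasing (fun s => (f s).1) -> (forall s, exponents m (f s).2) ->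
    ~ (forall s, (f s).2 = 0) ->
    average (fun n => monomial (fun s => (f s).1) (fun s => (f s).2)
               (zpath n w)) @ \oo --> (0 : R[i])}.
  apply/ae_foralln => r; apply: ae_forall_countable => f.
  have [finc|] := pselect (increasing (fun s => (f s).1)); last by move=> nf; apply: aeW.
  have [fm|] := pselect (forall s, exponents m (f s).2); last by move=> nf; apply: aeW.
  have [f0|f0] := pselect (forall s, (f s).2 = 0); first by apply: aeW.
  by apply: filterS (average_monomial_cvg0 finc fm f0).
apply: filterS h => w h r a i _ ainc im i0.
rewrite average_path.
have := h r [ffun s => (a s, i s)].
have -> : (fun s => ([ffun s => (a s, i s)] s).1) = a.
  by apply/funext => s; rewrite ffunE.
have -> : (fun s => ([ffun s => (a s, i s)] s).2) = i.
  by apply/funext => s; rewrite ffunE.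
apply=> // [s|h0]; first by rewrite ffunE; exact: im.
by apply: i0 => s; rewrite -(h0 s) ffunE.
Qed.

End Main.

Theorem proposition6p1 (R : realType) (d : measure_display)
    (T : measurableType d) (P : probability T R)
    (Z : nat -> {RV P >-> borelC R}) (m : option nat) :
  (forall n w, (@unit_circle R `|` [set 0]) (Z n w)) ->
  stationary P Z ->
  is_order m ->
  {ae P, forall w, has_index (fun n => Z n w) m} ->
  ({ae P, forall w, is_chowla (fun n => Z n w)} <->
   forall (r : nat) (a : 'I_r -> nat) (i : 'I_r -> int),
     (1 <= r)%N -> (forall s, (1 <= a s)%N) -> increasing a ->
     (forall s, exponents m (i s)) -> ~ (forall s, i s = 0) ->
     expectationC P (fun w => \prod_(s < r) cpow (Z (a s) w) (i s)) = 0).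
Proof.
move=> Zdisk statZ m_order m_index.
split=> [chowla r a i r1 _ ainc im i0|expectation0].
- have -> : (fun w => \prod_(s < r) cpow (Z (a s) w) (i s)) =
      (fun w => monomial a i (sample_path (Z := Z) 0 w)).
    by apply/funext => w; exact: prod_path0.
  apply: chowla_expectation_eq0 => //.
  (* [is_chowla] only provides some index m' of the path; uniqueness of the index identifies it with
     m. *)
  apply: filterS2 chowla m_index => w [m' idx' ch] idx.
  rewrite -average_path; apply: ch => // s.
  by rewrite -(has_index_unique idx idx').
- apply: filterS2 m_index
    (chowla_averages_ae Zdisk statZ m_order m_index expectation0).
  by move=> w idx ch; exists m.
Qed.
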